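(* Let $M\ge 1$, $N\ge 2$, let $k_1,\dots,k_M>0$ be wave numbers, let $x_1,\dots,x_N$ be the imaging pixels with total path lengths $L_1,\dots,L_N$, and let $A=(e^{-jk_iL_n})_{1\le i\le M,\,1\le n\le N}$ be the sensing matrix. Assume that two point targets are located at pixels $x_p$ and $x_q$ ($p\neq q$), i.e. the exact solution $X^o\in\mathbb{C}^N$ has $p$-th and $q$-th entries equal to $1$ and all other entries equal to $0$. Let $b=AX^o$ and $\tilde X=A^*b$, and write the two reconstructed values as $\tilde X_p=Ce^{j\theta}$ and $\tilde X_q=Ce^{-j\theta}$, where $C\ge 0$ is the magnitude and $\theta$, $-\theta$ are the phases. If the trivial case $C=0$ is excluded (so $C>0$), then $\theta=0$ (modulo $2\pi$) if and only if $\sum_{i=1}^M \sin\bigl(k_i(L_p-L_q)\bigr)=0$.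
   Context: Setting: a noiseless linear imaging system $AX=b$ with a single transmitter $T_x$, a single receiver $R_x$, and $M$ frequencies with wave numbers $k_1,\dots,k_M>0$. The imaging area has $N$ pixels located at points $x_1,\dots,x_N$ of Euclidean space, and $L_n=|T_x-x_n|+|x_n-R_x|$ is the total path length from the transmitter to $x_n$ and then to the receiver. Here $j$ is the imaginary unit. The sensing matrix $A$ is the $M\times N$ complex matrix with $(i,n)$ entry $e^{-jk_iL_n}$, and $A^*$ is its conjugate transpose. The data are generated synthetically (''inverse crime'') by $b=AX^o$, where $X^o\in\mathbb{C}^N$ is the exact reflectivity vector (interference between the targets is neglected), and the reconstructed solution is $\tilde X=A^*b$. The reconstructed values of the point targets at pixels $x_p,x_q$ are the entries $\tilde X_p,\tilde X_q$, which are complex conjugates of each other. Phases are considered modulo $2\pi$ (wrapped phase). *)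

(* Defs.v *)
From mathcomp Require Import all_boot all_order all_algebra.
From mathcomp Require Import complex.
From mathcomp Require Import reals trigo.

Set Implicit Arguments.
Unset Strict Implicit.
Unset Printing Implicit Defensive.

Import Order.TTheory GRing.Theory Num.Theory.
Local Open Scope ring_scope.
Local Open Scope sesquilinear_scope.

(* exp(j t) for a real phase t, by Euler's formula. *)
Definition expj {R : realType} (t : R) : R[i] := Complex (cos t) (sin t).

(* The canonical norm of MathComp-Analysis on row vectors is the sup norm, so
   the Euclidean distance is defined explicitly. *)
Definition edist {R : realType} {d : nat} (x y : 'rV[R]_d) : R :=
  Num.sqrt (\sum_(i < d) (x 0 i - y 0 i) ^+ 2).

Definition path_length {R : realType} {d : nat} (Tx Rx x : 'rV[R]_d) : R :=
  edist Tx x + edist x Rx.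

Definition sensing_matrix {R : realType} {M N : nat}
    (k : 'I_M -> R) (L : 'I_N -> R) : 'M[R[i]]_(M, N) :=
  \matrix_(i < M, n < N) expj (- (k i * L n)).

Definition conj_transpose {R : realType} {M N : nat} (A : 'M[R[i]]_(M, N)) :
  'M[R[i]]_(N, M) := A ^t*.

Definition eq_mod_2pi {R : realType} (s t : R) : Prop :=
  exists m : int, s - t = m%:~R * (2 * pi).

(* Main.v *)
(* With D = L_p - L_q the two reconstructed values are S and conj S, where
    S = sum_i (1 + exp(j k_i D)).  Each 1 + cos(k_i D) is nonnegative, so
    C cos(theta) = Re S >= 0, and theta = 0 mod 2 pi as soon as
    C sin(theta) = Im S = sum_i sin(k_i D) vanishes. *)

Require Import Defs.
From mathcomp Require Import all_boot all_order all_algebra.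
From mathcomp Require Import complex.
From mathcomp Require Import reals trigo.
From mathcomp Require Import lra.

Set Implicit Arguments.
Unset Strict Implicit.
Unset Printing Implicit Defensive.

Import Order.TTheory GRing.Theory Num.Theory.
Local Open Scope ring_scope.

Lemma cosD_mul2pi (R : realType) (t : R) (m : int) :
  cos (t + m%:~R * (2 * pi)) = cos t.
Proof.
have cosn (u : R) (n : nat) : cos (u + n%:R * (2 * pi)) = cos u.
  rewrite -[RHS](periodicn (@cosD2pi R) n u); congr (cos (u + _)).
  by rewrite mulr_natl mulr_natl.
case: m => n; first exact: cosn.
(* [Negz n] stands for [-(n+1)]; applying the natural case at the shifted argument adds these [n.+1]
   periods back. *)
by rewrite NegzE mulrNz mulNr -(cosn _ n.+1) subrK.
Qed.

Lemma sin_eq0_itv (R : realType) (t : R) : 0 <= t < pi -> sin t = 0 -> t = 0.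
Proof.
move=> /andP[t0 tpi] st0; apply/eqP; rewrite eq_le t0 andbT leNgt.
apply/negP => tpos; have : 0 < sin t by apply: sin_gt0_pi; rewrite tpos.
by rewrite st0 ltxx.
Qed.

(** Reducing [t] to [s] in one period puts [s / 2] in [[0, pi)], where the sine has no zero but 0;
    the double-angle formula turns [cos s = 1] into [sin (s / 2) = 0]. *)
Lemma cos_eq1 (R : realType) (t : R) : cos t = 1 <-> eq_mod_2pi t 0.
Proof.
have pi0 : 0 < pi :> R := pi_gt0 R.
rewrite /eq_mod_2pi subr0; split=> [ct|[m ->]]; last first.
  by rewrite -[_ * _]add0r cosD_mul2pi cos0.
(* The floor counts the full turns in [t], which leaves [s] in [[0, 2 pi)]. *)
pose m := Num.floor (t / (2 * pi)); pose s := t - m%:~R * (2 * pi).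
exists m; suff : s = 0 by rewrite /s; lra.
have cs : cos s = 1 by rewrite -ct -(cosD_mul2pi s m) subrK.
have p2 : 0 < 2 * pi :> R by lra.
have /andP[s0 s2] : 0 <= s < 2 * pi.
  have /andP[] := floor_itv (t / (2 * pi)).
  rewrite -/m ler_pdivlMr// ltr_pdivrMr// intrD => h1 h2.
  by apply/andP; rewrite /s; lra.
suff : s / 2 = 0 by lra.
apply: sin_eq0_itv; first lra.
apply/eqP; rewrite -sqrf_eq0 sin2cos2; apply/eqP.
have := cos_mulr2n (s / 2); rewrite mulr2n -splitr cs; lra.
Qed.

Lemma unit_circle_angle (R : realType) (c s : R) :
  c ^+ 2 + s ^+ 2 = 1 -> exists t : R, cos t = c /\ sin t = s.
Proof.
move=> cs1; have c1 : -1 <= c <= 1 by apply/andP; split; nra.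
have cK : cos (acos c) = c by apply: acosK; rewrite in_itv.
have sK : sin (acos c) = `|s|.
  by rewrite sin_acos// -cs1 addrAC subrr add0r sqrtr_sqr.
(* [acos] only reaches the upper half circle, so a negative [s] calls for the opposite angle. *)
have [s0|s0] := leP 0 s.
  by exists (acos c); rewrite sK ger0_norm.
by exists (- acos c); rewrite cosN sinN sK ltr0_norm ?opprK.
Qed.

Lemma polar_form (R : realType) (z : R[i]) :
  exists C t : R, 0 <= C /\ z = real_complex R C * expj t.
Proof.
case: z => a b; pose C := Num.sqrt (a ^+ 2 + b ^+ 2).
have C2 : C ^+ 2 = a ^+ 2 + b ^+ 2 by rewrite sqr_sqrtr ?addr_ge0 ?sqr_ge0.
exists C; have [C0|C0] := eqVneq C 0.
  (* At the origin every angle would do; 0 is an arbitrary choice. *)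
  exists 0; split; first exact: sqrtr_ge0.
  move: C2; rewrite C0 expr0n /= => /esym/eqP.
  rewrite paddr_eq0 ?sqr_ge0// !sqrf_eq0 => /andP[/eqP-> /eqP->].
  by rewrite mul0r.
have [t [ct st]] : exists t : R, cos t = a / C /\ sin t = b / C.
  apply: unit_circle_angle.
  by rewrite !expr_div_n -mulrDl -C2 divff// sqrf_eq0.
exists t; split; first exact: sqrtr_ge0.
rewrite /expj ct st; apply/eqP; rewrite eq_complex /=.
by rewrite !mul0r subr0 addr0 ![C * _]mulrC !divfK// !eqxx.
Qed.

Lemma conjc_expj (R : realType) (t : R) : conjc (expj t) = expj (- t).
Proof. by rewrite /expj /= cosN sinN. Qed.

Lemma expjD (R : realType) (s t : R) : expj (s + t) = expj s * expj t.
Proof.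
by apply/eqP; rewrite eq_complex /= cosD sinD eqxx /= addrC.
Qed.

Lemma expj0 (R : realType) : expj 0 = 1 :> R[i].
Proof. by rewrite /expj cos0 sin0. Qed.

Lemma conj_transposeE (R : realType) (M N : nat) (A : 'M[R[i]]_(M, N)) i n :
  conj_transpose A n i = conjc (A i n).
Proof. by rewrite !mxE. Qed.

(** Only columns [p] and [q] survive in [A X]. Conjugation flips the sign of the phase in row [r] of
    the adjoint, so the products of exponentials carry path differences. *)
Lemma two_target_reconstruction (R : realType) (M N : nat)
    (k : 'I_M -> R) (L : 'I_N -> R) (p q r : 'I_N) (X : 'cV[R[i]]_N) :
  p <> q -> X p 0 = 1 -> X q 0 = 1 ->
  (forall n, n <> p -> n <> q -> X n 0 = 0) ->
  (conj_transpose (sensing_matrix k L) *m (sensing_matrix k L *m X)) r 0 =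
  \sum_(i < M) (expj (k i * (L r - L p)) + expj (k i * (L r - L q))).
Proof.
move=> pq Xp Xq X0; rewrite mxE; apply: eq_bigr => i _.
rewrite conj_transposeE !mxE conjc_expj (bigD1 p)//= (bigD1 q)/=; last first.
  by apply/eqP/nesym.
rewrite big1 => [|n /andP[/eqP np /eqP nq]]; last by rewrite X0 ?mulr0.
rewrite !mxE Xp Xq !mulr1 addr0 mulrDr -!expjD.
by rewrite opprK !mulrBr.
Qed.

Lemma Re_sum (R : realType) (M : nat) (F : 'I_M -> R[i]) :
  complex.Re (\sum_i F i) = \sum_i complex.Re (F i).
Proof. by apply: (big_morph _ _ _) => // -[? ?] [? ?]. Qed.

Lemma Im_sum (R : realType) (M : nat) (F : 'I_M -> R[i]) :
  complex.Im (\sum_i F i) = \sum_i complex.Im (F i).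
Proof. by apply: (big_morph _ _ _) => // -[? ?] [? ?]. Qed.

Theorem theorem5 (R : realType) (d M N : nat) (hM : (1 <= M)%N) (hN : (2 <= N)%N)
    (k : 'I_M -> R) (hk : forall i, 0 < k i)
    (Tx Rx : 'rV[R]_d) (x : 'I_N -> 'rV[R]_d)
    (L : 'I_N -> R) (hL : forall n, L n = path_length Tx Rx (x n))
    (A : 'M[R[i]]_(M, N)) (hA : A = sensing_matrix k L)
    (p q : 'I_N) (hpq : p <> q)
    (Xo : 'cV[R[i]]_N) (hp : Xo p 0 = 1) (hq : Xo q 0 = 1)
    (h0 : forall n, n <> p -> n <> q -> Xo n 0 = 0)
    (b : 'cV[R[i]]_M) (hb : b = A *m Xo)
    (Xt : 'cV[R[i]]_N) (hXt : Xt = conj_transpose A *m b) :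
  (exists C theta : R, [/\ 0 <= C,
      Xt p 0 = real_complex R C * expj theta &
      Xt q 0 = real_complex R C * expj (- theta)]) /\
  (forall C theta : R,
      0 <= C ->
      Xt p 0 = real_complex R C * expj theta ->
      Xt q 0 = real_complex R C * expj (- theta) ->
      C <> 0 ->
      (eq_mod_2pi theta 0 <-> \sum_(i < M) sin (k i * (L p - L q)) = 0)).
Proof.
have Xtr r : Xt r 0 =
    \sum_(i < M) (expj (k i * (L r - L p)) + expj (k i * (L r - L q))).
  by rewrite hXt hb hA; apply: two_target_reconstruction.
have Xtp : Xt p 0 = \sum_(i < M) (1 + expj (k i * (L p - L q))).
  by rewrite Xtr; apply: eq_bigr => i _; rewrite subrr mulr0 expj0.
(* At its own pixel each target contributes 1 per frequency; the cross terms at [p] and [q] have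
   opposite phases. *)
have Xtq : Xt q 0 = conjc (Xt p 0).
  rewrite Xtr Xtp rmorph_sum; apply: eq_bigr => i _.
  rewrite rmorphD rmorph1 [X in _ = _ + X]conjc_expj subrr mulr0 expj0 addrC.
  by rewrite -mulrN opprB.
split.
  have [C [t [C0 XtpE]]] := polar_form (Xt p 0).
  exists C, t; split=> //.
  (* Conjugation fixes the real magnitude and negates the angle, so one polar form serves both
     pixels. *)
  by rewrite Xtq XtpE rmorphM [X in X * _]conjc_real [X in _ * X]conjc_expj.
move=> C t C0 XtpE _ /eqP Cn0.
have ReE : C * cos t = \sum_(i < M) (1 + cos (k i * (L p - L q))).
  have := congr1 (@complex.Re R) XtpE.
  by rewrite Xtp Re_sum /= mul0r subr0 => <-.
have ImE : C * sin t = \sum_(i < M) sin (k i * (L p - L q)).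
  have := congr1 (@complex.Im R) XtpE.
  rewrite Xtp Im_sum /= mul0r addr0 => <-.
  by apply: eq_bigr => i _; rewrite /= add0r.
have ct0 : 0 <= cos t.
  rewrite -(pmulr_rge0 _ (_ : 0 < C)) ?lt_def ?Cn0// ReE sumr_ge0// => i _.
  by have := cos_geN1 (k i * (L p - L q)); lra.
rewrite -ImE -cos_eq1; split=> [ct1|/eqP].
  suff -> : sin t = 0 by rewrite mulr0.
  by apply/eqP; rewrite -sqrf_eq0 sin2cos2 ct1 expr1n subrr.
(* A vanishing sine only gives a cosine of absolute value 1; [ct0] excludes -1, that is, the phase
   [pi]. *)
rewrite mulf_eq0 (negbTE Cn0) /= -norm_cos_eq1 ger0_norm// => /eqP.
exact.
Qed.
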